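(* Let $k\geq 1$ be a given integer. Suppose that $f:(0,\infty)\to\mathbb{R}$ is of the form $$f(x)=\int_0^{\infty}e^{-xt}p(t)\,dt,\quad x>0,$$ where, for some measures $\mu_0,\ldots,\mu_{k-1}\in\mathcal{A}_0$, $t^jp^{(j)}(t)\in\mathcal{A}_1(\mu_j)$ for all $0\leq j\leq k-1$, and that $$d\mu_k(t)=t\,d\mu_{k-1}(t)-(k-1)\mu_{k-1}([0,t])\,dt$$ is a positive measure on $[0,\infty)$. Then $x\mapsto(-1)^j(x^jf(x))^{(j)}$ is completely monotonic for $0\leq j\leq k$, and for all $x>0$ $$(-1)^j(x^jf(x))^{(j)}=\int_0^{\infty}e^{-xt}t^jp^{(j)}(t)\,dt,\quad 0\leq j\leq k-1,$$ $$(-1)^k(x^kf(x))^{(k)}=\int_0^{\infty}e^{-xt}\,d\mu_k(t).$$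
   Context: A function $g:(0,\infty)\to\mathbb{R}$ is completely monotonic if it is infinitely often differentiable on $(0,\infty)$ and $(-1)^ng^{(n)}(x)\geq 0$ for all $n\geq 0$ and all $x>0$. $\mathcal{A}_0$ denotes the set of positive Borel measures $\sigma$ on $[0,\infty)$ such that $\int_0^{\infty}e^{-xs}\,d\sigma(s)<\infty$ for all $x>0$. For $\sigma\in\mathcal{A}_0$, $\xi\in\mathcal{A}_1(\sigma)$ means that $\xi$ is the function $t\mapsto\sigma([0,t])$. Convention on derivatives of $p$: for $j=0$, $p(t)=\mu_0([0,t])$ for all $t\geq 0$. If $k\geq 2$, then $p$ is assumed $k-2$ times continuously differentiable on $(0,\infty)$ with $p^{(k-2)}$ locally absolutely continuous on $(0,\infty)$, and $p^{(k-1)}$ denotes its almost everywhere defined derivative (density); for $1\leq j\leq k-1$ the relation $t^jp^{(j)}(t)\in\mathcal{A}_1(\mu_j)$ means $t^jp^{(j)}(t)=\mu_j([0,t])$ for all $t>0$ if $j\leq k-2$, and for almost every $t>0$ if $j=k-1$. *)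

(* Defs.v *)
From HB Require Import structures.
From mathcomp Require Import all_boot all_order all_algebra.
From mathcomp Require Import all_classical all_reals all_analysis.
Import Order.TTheory GRing.Theory Num.Theory.
Import numFieldNormedType.Exports.

Set Implicit Arguments.
Unset Strict Implicit.
Unset Printing Implicit Defensive.

Local Open Scope classical_set_scope.
Local Open Scope ring_scope.

(* Functions on (0, +oo) are total functions R -> R whose values outside
   (0, +oo) are irrelevant: iterated derivatives at x > 0 are local.
   [derive1n n g] takes an unspecified value where a derivative does not
   exist, so differentiability is always required separately. *)
Definition completely_monotonic (R : realType) (g : R -> R) : Prop :=
  forall (n : nat) (x : R), 0 < x ->
    derivable (derive1n n g) x 1 /\ 0 <= (-1) ^+ n * derive1n n g x.

(* A Borel measure on [0, +oo) is a Borel measure on R that does not charge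
   the negative half-line. *)
Definition on_nneg (R : realType)
    (sigma : {measure set (measurableTypeR R) -> \bar R}) : Prop :=
  sigma `]-oo, 0%R[%classic = 0%E.

Definition in_A0 (R : realType)
    (sigma : {measure set (measurableTypeR R) -> \bar R}) : Prop :=
  on_nneg sigma /\
  forall x : R, 0 < x ->
    (\int[sigma]_(s in `[0%R, +oo[) (expR (- (x * s)))%:E < +oo)%E.

Definition abs_continuous_on (R : realType) (a b : R) (g : R -> R) : Prop :=
  forall e : R, 0 < e -> exists2 d : R, 0 < d &
    forall (n : nat) (u v : 'I_n -> R),
      (forall i, a <= u i /\ u i <= v i /\ v i <= b) ->
      trivIset [set: 'I_n] (fun i => `]u i, v i[%classic) ->
      \sum_(i < n) (v i - u i) < d ->
      \sum_(i < n) `|g (v i) - g (u i)| < e.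

Definition locally_abs_continuous (R : realType) (g : R -> R) : Prop :=
  forall a b : R, 0 < a -> a <= b -> abs_continuous_on a b g.

Definition continuously_differentiable (R : realType) (m : nat) (g : R -> R)
    : Prop :=
  (forall i : nat, (i < m)%N -> forall t : R, 0 < t ->
     derivable (derive1n i g) t 1) /\
  (forall i : nat, (i <= m)%N -> forall t : R, 0 < t ->
     {for t, continuous (derive1n i g)}).

(* t^j p^(j)(t) = mu_j([0, t]) for 0 <= j <= k - 1.  For k >= 2 the last
   derivative exists only almost everywhere; it is the pointwise derivative
   of p^(k-2), so the relation at t includes its existence at t. *)
Definition derivatives_in_A1 (R : realType) (k : nat) (p : R -> R)
    (mu : nat -> {measure set (measurableTypeR R) -> \bar R}) : Prop :=
  (forall t : R, 0 <= t -> (p t)%:E = mu 0%N `[0%R, t]%classic) /\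
  ((2 <= k)%N ->
    [/\ continuously_differentiable (k - 2) p,
        locally_abs_continuous (derive1n (k - 2) p),
        (forall j : nat, (1 <= j <= k - 2)%N -> forall t : R, 0 < t ->
           (t ^+ j * derive1n j p t)%:E = mu j `[0%R, t]%classic) &
        {ae (@lebesgue_measure R), forall t : R, 0 < t ->
           derivable (derive1n (k - 2) p) t 1 /\
           (t ^+ (k - 1) * derive1n (k - 1) p t)%:E = mu (k - 1)%N `[0%R, t]%classic}]).

(* nu is the positive measure d nu = t d sigma - c sigma([0, t]) dt on
   [0, +oo).  Both terms may be infinite on unbounded sets, so the equality is
   required on bounded Borel sets, which determines nu. *)
Definition is_weighted_difference (R : realType) (c : R)
    (sigma nu : {measure set (measurableTypeR R) -> \bar R}) : Prop :=
  on_nneg nu /\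
  forall (M : R) (B : set (measurableTypeR R)),
    measurable B -> B `<=` `[0%R, M]%classic ->
    (nu B = \int[sigma]_(t in B) t%:E
            - c%:E * \int[@lebesgue_measure R]_(t in B) sigma `[0%R, t]%classic)%E.

(* Main.v *)
(** Write G_j(t) = mu_j([0,t]), L for the Laplace transform with respect to dt,
    and F_j = (-1)^j (x^j f)^(j).  Since x^(j+1) f = x (x^j f), the Leibniz rule
    gives F_(j+1) = - x F_j' - (j+1) F_j, so if F_j = L G_j then
    F_(j+1) = x L(t G_j) - (j+1) L G_j.  Now t G_j = t^(j+1) p^(j) is the primitive
    of (j+1) G_j + G_(j+1) when j + 1 < k, while Tonelli's theorem gives
    t G_(k-1)(t) = mu_k([0,t]) + k int_0^t G_(k-1).  As x L turns a primitive
    into the Laplace transform of its derivative (Tonelli again), this yields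
    F_(j+1) = L G_(j+1), respectively the Laplace transform of mu_k, and Laplace
    transforms of positive measures are completely monotonic.  The primitive
    property at the last derivative, which exists only almost everywhere, rests on
    the constancy of locally absolutely continuous functions whose derivative
    vanishes almost everywhere. *)
Require Import Defs.
From HB Require Import structures.
From mathcomp Require Import all_boot all_order all_algebra.
From mathcomp Require Import all_classical all_reals all_analysis.
From mathcomp Require Import measurable_realfun simple_functions zify ring lra.
Set Implicit Arguments.
Unset Strict Implicit.

Import Order.TTheory GRing.Theory Num.Theory.
Import numFieldNormedType.Exports.
Local Open Scope classical_set_scope.
Local Open Scope ring_scope.

(** * Integrals of almost everywhere equal functions, one of them possibly not measurable *)

Section ae_integral.
Context {d : measure_display} {T : measurableType d} {R : realType}.
Variable mu : {measure set T -> \bar R}.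
Local Open Scope ereal_scope.
Import HBNNSimple.

(** The integral is a supremum over simple functions, which are measurable. Such a function below
    [f] lies below [g] off the null set [N], which gives one inequality; conversely, a simple
    function below [g] cut off on [N] lies below [f]. *)
Lemma ge0_ae_eq_integral_measurabler (D : set T) (f g : T -> \bar R) :
  measurable D -> measurable_fun D g ->
  (forall x, D x -> 0 <= f x) -> (forall x, D x -> 0 <= g x) ->
  ae_eq mu D f g -> \int[mu]_(x in D) f x = \int[mu]_(x in D) g x.
Proof.
move=> mD mg f0 g0 [N [mN N0 sub]].
have mg' : measurable_fun setT (g \_ D).
  by apply/(measurable_restrictT _ mD).
have g'0 x : 0 <= (g \_ D) x.
  by rewrite patchE; case: ifPn => //; rewrite inE; exact: g0.
have f'0 x : 0 <= (f \_ D) x.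
  by rewrite patchE; case: ifPn => //; rewrite inE; exact: f0.
have fg x : ~ N x -> (f \_ D) x = (g \_ D) x.
  move=> Nx; rewrite !patchE; case: ifPn => //; rewrite inE => Dx.
  by apply: contrapT => h; apply: Nx; apply: sub => /= /(_ Dx).
rewrite integral_mkcond [RHS]integral_mkcond.
apply/le_anti/andP; split.
  rewrite ge0_integralTE//; apply: ge_ereal_sup => _ [h hf <-].
  rewrite -integralT_nnsfun.
  have mh : measurable_fun setT (EFin \o h) by exact/measurable_EFinP.
  rewrite (@ge0_negligible_integral _ _ _ _ setT N)//; last first.
    by move=> x _; rewrite lee_fin.
  rewrite [leRHS](@ge0_negligible_integral _ _ _ _ setT N)//.
  apply: ge0_le_integral => //.
  - exact: measurableD.
  - by move=> x _; rewrite lee_fin.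
  - exact: measurable_funTS.
  - exact: measurable_funTS.
  - by move=> x [_ Nx]; rewrite -fg//; exact: hf.
rewrite (@ge0_negligible_integral _ _ _ _ setT N)// integral_mkcond.
have p0 x : 0 <= ((g \_ D) \_ ([set: T] `\` N)) x.
  by rewrite patchE; case: ifPn.
rewrite !ge0_integralTE//; apply: ereal_sup_le => _ [h hf <-]; exists h => //= x.
apply: (le_trans (hf x)); rewrite patchE; case: ifPn => //; rewrite inE => -[_ Nx].
by rewrite fg.
Qed.

(* [f] need not be measurable: Lebesgue measure is not complete on Borel sets. *)
Lemma ae_eq_integral_measurabler (D : set T) (f g : T -> \bar R) :
  measurable D -> measurable_fun D g ->
  ae_eq mu D f g -> \int[mu]_(x in D) f x = \int[mu]_(x in D) g x.
Proof.
move=> mD mg /ae_eq_funeposneg[fgp fgn].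
rewrite integralE [RHS]integralE; congr (_ - _).
  by apply: ge0_ae_eq_integral_measurabler => //; exact: measurable_funepos.
by apply: ge0_ae_eq_integral_measurabler => //; exact: measurable_funeneg.
Qed.

End ae_integral.

(** * Iterated derivatives on the open half-line *)

Section positive_half_line_calculus.
Context {R : realType}.
Implicit Types f g u : R -> R.

Definition smooth_pos u :=
  forall n x, 0 < x -> derivable (derive1n n u) x 1.

Lemma near_pos (P : R -> Prop) (x : R) :
  0 < x -> (forall y, 0 < y -> P y) -> \forall y \near x, P y.
Proof. by move=> x0 HP; near=> y; apply: HP; near: y; exact: lt_nbhsr.
Unshelve. all: by end_near. Qed.

Lemma eq_derive1n_pos f g : (forall x, 0 < x -> f x = g x) ->
  forall n x, 0 < x -> derive1n n f x = derive1n n g x.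
Proof.
move=> fg; elim=> [|n IH] x x0 //; first exact: fg.
rewrite !derive1nS !derive1E; apply: near_eq_derive.
exact: near_pos.
Qed.

Lemma eq_smooth_pos f g : (forall x, 0 < x -> f x = g x) ->
  smooth_pos f -> smooth_pos g.
Proof.
move=> fg sf n x x0; apply: (near_eq_derivable _ (sf n x x0)).
by apply: near_pos => // y; exact: eq_derive1n_pos.
Qed.

(** Reduces smoothness and the computation of all derivatives to a guessed sequence [D], checked one
    derivative at a time. *)
Lemma smooth_pos_seq (D : nat -> R -> R) f :
  (forall x, 0 < x -> f x = D 0%N x) ->
  (forall (n : nat) (x : R), 0 < x -> is_derive x 1 (D n) (D n.+1 x)) ->
  smooth_pos f /\ (forall n x, 0 < x -> derive1n n f x = D n x).
Proof.
move=> fD dD.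
have E n x : 0 < x -> derive1n n f x = D n x.
  elim: n x => [|n IH] x x0; first exact: fD.
  rewrite derive1nS derive1E (@near_eq_derive _ _ _ _ (D n)).
    by have [_ ->] := dD n x x0.
  exact: near_pos.
split=> // n x x0; apply: (@near_eq_derivable _ _ _ (D n)).
  by apply: near_pos => // y y0; rewrite E.
by have [] := dD n x x0.
Qed.

Lemma is_derive_derive1n u n (x : R) : smooth_pos u -> 0 < x ->
  is_derive x 1 (derive1n n u) (derive1n n.+1 u x).
Proof.
by move=> su x0; split; [exact: su|rewrite derive1nS derive1E].
Qed.

(** The factor [y] has zero second derivative, so only two Leibniz terms remain. At [n = 0] the
    predecessor [n.-1] is [0], harmless because its coefficient [n%:R] vanishes. *)
Lemma leibniz_id_mul u : smooth_pos u ->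
  smooth_pos (fun y => y * u y) /\
  (forall n x, 0 < x -> derive1n n (fun y => y * u y) x =
     x * derive1n n u x + n%:R * derive1n n.-1 u x).
Proof.
move=> su; apply: (@smooth_pos_seq
  (fun n x => x * derive1n n u x + n%:R * derive1n n.-1 u x)).
  by move=> x x0; rewrite mul0r addr0.
move=> [|n] x x0.
  have d := is_derive_derive1n 0 su x0.
  rewrite (_ : (fun y => _) = (id * derive1n 0 u)); last first.
    by apply/funext => y; rewrite mul0r addr0.
  apply: (is_derive_eq (is_deriveM (is_derive_id x 1) d)).
  by rewrite /GRing.scale /= !mulr1 mul1r.
have d0 := is_derive_derive1n n su x0.
have d1 := is_derive_derive1n n.+1 su x0.
apply: (is_derive_eq (is_deriveD (is_deriveM (is_derive_id x 1) d1)
  (is_deriveZ n.+1%:R d0))).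
rewrite /GRing.scale /= !mulr1 -addrA -[in n.+2%:R]addn1 natrD mulrDl mul1r.
by rewrite (addrC (n.+1%:R * _)).
Qed.

End positive_half_line_calculus.

(** * Laplace transforms of weighted measures and their derivatives *)

Section laplace_transform.
Context {R : realType}.
Variable sigma : {measure set (measurableTypeR R) -> \bar R}.
Implicit Type w : R -> R.
Local Notation Rge0 := `[0%R, +oo[%classic.

(** The weight [w] covers both uses: Lebesgue measure with a distribution function as density, and
    the measure [mu k] with [w = 1]. *)
Definition laplace w (x : R) : R :=
  \int[sigma]_(t in Rge0) (expR (- (x * t)) * w t).

Definition has_laplace w :=
  [/\ measurable_fun (Rge0 : set R) w, (forall t, 0 <= t -> 0 <= w t) &
    forall x : R, 0 < x ->
      sigma.-integrable Rge0 (EFin \o (fun t => expR (- (x * t)) * w t))].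

Lemma measurable_expRN (x : R) (D : set R) :
  measurable_fun D (fun t : R => expR (- (x * t))).
Proof.
apply: measurable_funTS; apply: measurableT_comp => //.
by apply: measurableT_comp => //; exact: measurable_funM.
Qed.

Lemma has_laplaceP w : measurable_fun (Rge0 : set R) w ->
  (forall t, 0 <= t -> 0 <= w t) ->
  (forall x : R, 0 < x ->
    (\int[sigma]_(t in Rge0) (expR (- (x * t)) * w t)%:E < +oo)%E) ->
  has_laplace w.
Proof.
move=> mw w0 Hx; split=> // x x0; apply/integrableP; split.
  apply/measurable_EFinP; apply: measurable_funM => //.
  exact: measurable_expRN.
apply: le_lt_trans (Hx x x0); rewrite le_eqVlt; apply/orP; left; apply/eqP.
apply: eq_integral => t; rewrite inE /= in_itv /= andbT => t0.
by rewrite ger0_norm// mulr_ge0 ?expR_ge0// w0.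
Qed.

Lemma EFin_laplace w x : has_laplace w -> 0 < x ->
  (laplace w x)%:E = (\int[sigma]_(t in Rge0) (expR (- (x * t)) * w t)%:E)%E.
Proof.
move=> [_ _ iw] x0; rewrite /laplace /Rintegral fineK//.
exact: integrable_fin_num (iw x x0).
Qed.

Lemma laplace_ge0 w x : has_laplace w -> 0 <= laplace w x.
Proof.
move=> [_ w0 _]; apply: Rintegral_ge0 => t /=; rewrite in_itv /= andbT => t0.
by rewrite mulr_ge0 ?expR_ge0// w0.
Qed.

(** Half of the exponential absorbs the factor: [t e^(-x t) <= (2 / x) e^(-x t / 2)], so the
    transform of [w] at [x / 2] dominates. *)
Lemma has_laplace_mul_id w : has_laplace w -> has_laplace (fun t => t * w t).
Proof.
move=> [mw w0 iw]; split.
- by apply: measurable_funM.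
- by move=> t t0; rewrite mulr_ge0// w0.
move=> x x0; have x20 : 0 < x / 2 by rewrite divr_gt0.
have i2 : sigma.-integrable Rge0
    (fun t => ((2 / x)%:E * (expR (- (x / 2 * t)) * w t)%:E)%E).
  by apply: integrableZl => //; exact: iw.
apply: le_integrable i2 => //.
  apply/measurable_EFinP; apply: measurable_funM; first exact: measurable_expRN.
  exact: measurable_funM.
move=> t /=; rewrite in_itv /= andbT => t0.
rewrite -?EFinM !lee_fin.
rewrite !ger0_norm ?mulr_ge0 ?divr_ge0 ?expR_ge0 ?w0 ?invr_ge0 ?(ltW x0)//.
rewrite !mulrA ler_wpM2r ?w0//.
have -> : - (x * t) = - (x / 2 * t) - x / 2 * t by field.
rewrite expRD [leRHS]mulrC -mulrA ler_wpM2l ?expR_ge0//.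
rewrite expRN ler_pdivrMl ?expR_gt0// [leRHS]mulrC.
have h := expR_ge1Dx (x / 2 * t).
rewrite [leLHS](_ : t = 2 / x * (x / 2 * t)); last first.
  by field; rewrite gt_eqF.
by rewrite ler_wpM2l ?divr_ge0 ?(ltW x0)//; lra.
Qed.

(** Differentiation under the integral on the neighbourhood []x / 2, 2 x[] of [x], where the
    derivative of the integrand is dominated by its modulus [G] at [x / 2]. *)
Lemma is_derive_laplace w (x : R) : has_laplace w -> 0 < x ->
  is_derive x 1 (laplace w) (- laplace (fun t => t * w t) x).
Proof.
move=> hw x0; have [mtw tw0 itw] := has_laplace_mul_id hw.
have [mw w0 iw] := hw.
pose f (y t : R) := expR (- (y * t)) * w t.
have df (y t : R) : is_derive y 1 (f ^~ t) (- (expR (- (y * t)) * (t * w t))).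
  rewrite (_ : f ^~ t = w t \*: (expR \o (fun y => - (y * t)))); last first.
    by apply/funext => z; rewrite /f mulrC.
  have dl : is_derive y 1 (fun y : R => - (y * t)) (- t).
    rewrite (_ : (fun y : R => _) = (- t) \*: id); last first.
      by apply/funext => z; rewrite /= /GRing.scale /= mulNr mulrC.
    apply: (is_derive_eq (is_deriveZ (- t) (is_derive_id y 1))).
    by rewrite /GRing.scale /= mulr1.
  apply: is_derive_eq.
  by rewrite /GRing.scale /=; ring.
have d1f y t : partial1of2 f y t = - (expR (- (y * t)) * (t * w t)).
  by rewrite partial1of2E; have [_ ->] := df y t.
pose G (t : R) := `|expR (- (x / 2 * t)) * (t * w t)|.
have x2 : 0 < x / 2 by rewrite divr_gt0.
have Ix : `]x / 2, 2 * x[%classic x by rewrite /= in_itv /=; apply/andP; split; lra.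
have intf y : `]x / 2, 2 * x[%classic y -> sigma.-integrable Rge0 (EFin \o f y).
  by rewrite /= in_itv /= => /andP[y0 _]; apply: iw; exact: lt_trans y0.
have derf y t : `]x / 2, 2 * x[%classic y -> Rge0 t -> derivable (f ^~ t) y 1.
  by move=> _ _; have [] := df y t.
have G0 t : 0 <= G t by exact: normr_ge0.
have intG : sigma.-integrable Rge0 (EFin \o G).
  exact: (integrable_abse (itw _ x2)).
have Gub y t : `]x / 2, 2 * x[%classic y -> Rge0 t -> `|partial1of2 f y t| <= G t.
  rewrite /= !in_itv /= andbT => /andP[xy _] t0.
  rewrite d1f normrN /G !normrM ler_wpM2r ?mulr_ge0//.
  by rewrite !ger0_norm ?expR_ge0// ler_expR lerN2 ler_wpM2r// ltW.
have mD : measurable (Rge0 : set (measurableTypeR R)) by [].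
split.
  exact: (derivable_under_integral mD Ix intf derf G0 intG Gub).
rewrite -derive1E.
rewrite (differentiation_under_integral mD Ix intf derf G0 intG Gub).
under eq_Rintegral do rewrite d1f -mulN1r.
by rewrite RintegralZl ?mulN1r//; exact: itw.
Qed.

Lemma has_laplace_mul_exp w n : has_laplace w ->
  has_laplace (fun t => t ^+ n * w t).
Proof.
move=> hw; elim: n => [|n /has_laplace_mul_id].
  by under eq_fun do rewrite mul1r.
by under eq_fun do rewrite mulrA -exprS.
Qed.

Lemma derive1n_laplace w : has_laplace w -> smooth_pos (laplace w) /\
  forall n (x : R), 0 < x -> derive1n n (laplace w) x =
    (-1) ^+ n * laplace (fun t => t ^+ n * w t) x.
Proof.
move=> hw; apply: (@smooth_pos_seq _
    (fun n x => (-1) ^+ n * laplace (fun t => t ^+ n * w t) x)).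
  by move=> x _; rewrite mul1r; under [in RHS]eq_fun do rewrite mul1r.
move=> n x x0.
have d := is_derive_laplace (has_laplace_mul_exp n hw) x0.
apply: (is_derive_eq (is_deriveZ ((-1) ^+ n) d)).
rewrite /GRing.scale /= exprS mulN1r mulrN mulNr; congr (- (_ * laplace _ _)).
by apply/funext => t; rewrite exprS mulrA.
Qed.

(** The easy half of Bernstein's theorem: each derivative brings out a factor [- t], so the signed
    derivatives are transforms of the nonnegative weights [t^n w]. *)
Lemma laplace_completely_monotonic (g : R -> R) w : has_laplace w ->
  (forall x, 0 < x -> g x = laplace w x) -> completely_monotonic g.
Proof.
move=> hw gw n x x0; have [sw dw] := derive1n_laplace hw.
split.
  by apply: eq_smooth_pos sw _ _ x0 => // y y0; rewrite gw.
rewrite (eq_derive1n_pos gw)// dw// signrMK.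
by apply: laplace_ge0; exact: has_laplace_mul_exp.
Qed.

End laplace_transform.

(** * Tonelli's theorem on a triangle *)

Section tonelli.
Context {R : realType}.
Local Notation leb := (@lebesgue_measure R).
Local Notation Rge0 := `[0%R, +oo[%classic.
Local Open Scope ereal_scope.

(** Both sides integrate [phi t * w s] over the triangle [0 <= s <= t], in the two orders of
    integration. *)
Lemma sigma_finite_tonelli_triangle
    (sigma : {sigma_finite_measure set (measurableTypeR R) -> \bar R})
    (phi w : R -> R) :
  measurable_fun setT phi -> (forall t, 0 <= phi t)%R ->
  measurable_fun setT w -> (forall t, 0 <= w t)%R ->
  \int[leb]_(t in Rge0) ((phi t)%:E * \int[sigma]_(s in `[0%R, t]) (w s)%:E) =
  \int[sigma]_(s in Rge0) ((w s)%:E * \int[leb]_(t in `[s, +oo[) (phi t)%:E).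
Proof.
move=> mphi phi0 mw w0.
have mphiE : measurable_fun setT (EFin \o phi) by exact/measurable_EFinP.
have mwE : measurable_fun setT (EFin \o w) by exact/measurable_EFinP.
have mw_ t : measurable_fun setT ((EFin \o w) \_ `[0%R, t]).
  by apply/(measurable_restrictT _ (measurable_itv _)); exact: measurable_funTS.
have mphi_ s : measurable_fun setT ((EFin \o phi) \_ `[s, +oo[).
  by apply/(measurable_restrictT _ (measurable_itv _)); exact: measurable_funTS.
pose A : set (measurableTypeR R * measurableTypeR R) :=
  [set p | (0 <= p.2)%R && (p.2 <= p.1)%R].
have mA : measurable A.
  have mf : measurable_fun setT
      (fun p : measurableTypeR R * measurableTypeR R =>
         (0 <= p.2)%R && (p.2 <= p.1)%R).
    by apply: measurable_and; apply: measurable_fun_ler.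
  by have := mf measurableT [set true] I; rewrite setTI; exact.
have memA t s : ((t, s) \in A) = (0 <= s)%R && (s <= t)%R.
  by apply/idP/idP => [/set_mem|h] //; exact: mem_set.
pose F (p : measurableTypeR R * measurableTypeR R) : \bar R :=
  (phi p.1 * w p.2 * \1_A p)%:E.
have mF : measurable_fun setT F.
  apply/measurable_EFinP; apply: measurable_funM; last exact: measurable_indic.
  by apply: measurable_funM; apply: measurableT_comp.
have F0 p : 0 <= F p by rewrite lee_fin !mulr_ge0.
have := fubini_tonelli (m1 := leb) (m2 := sigma) F mF F0.
(* For [t < 0] the slice of the triangle is empty, so the integral over the whole line restricts
   itself to [t >= 0]. *)
have -> : (fun t => \int[sigma]_s F (t, s)) =
    (fun t => (phi t)%:E * \int[sigma]_(s in `[0%R, t]) (w s)%:E) \_ Rge0.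
  apply/funext => t.
  transitivity ((phi t)%:E * \int[sigma]_(s in `[0%R, t]) (w s)%:E).
    rewrite [in RHS]integral_mkcond -ge0_integralZl_EFin//; last 2 first.
    - by move=> s _; rewrite patchE; case: ifPn => // _; rewrite lee_fin.
    - exact: mw_.
    apply: eq_integral => s _; rewrite /F /= indicE patchE memA mem_setE in_itv /=.
    by case: ifPn => _; rewrite ?mulr1// mulr0; exact/esym/mule0.
  rewrite patchE; case: ifPn => //; rewrite notin_setE /= in_itv /= andbT => /negP.
  rewrite -ltNge => t0.
  by rewrite set_itv_ge ?integral_set0 ?mule0// bnd_simp -ltNge.
have -> : (fun s => \int[leb]_t F (t, s)) =
    (fun s => (w s)%:E * \int[leb]_(t in `[s, +oo[) (phi t)%:E) \_ Rge0.
  apply/funext => s; rewrite patchE mem_setE /= in_itv /= andbT.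
  case: ifPn => s0; last first.
    apply: integral0_eq => t _; rewrite /F /= indicE memA.
    by rewrite (negbTE s0) mulr0.
  rewrite [in RHS]integral_mkcond -ge0_integralZl_EFin//; last 2 first.
  - by move=> t _; rewrite patchE; case: ifPn => // _; rewrite lee_fin.
  - exact: mphi_.
  apply: eq_integral => t _; rewrite /F /= indicE patchE memA mem_setE s0 in_itv /= andbT.
  by case: ifPn => _; rewrite ?mulr1 1?mulrC// mul0r; exact/esym/mule0.
by rewrite -!integral_mkcond.
Qed.

Definition bounded_finite (sigma : {measure set (measurableTypeR R) -> \bar R}) :=
  forall t : R, sigma `[0%R, t]%classic < +oo.

(** The half-lines []-oo, n]] exhaust the line, and each has at most the mass of [[0, n]] because
    the negative axis is null. *)
Lemma sigma_finite_nneg (sigma : {measure set (measurableTypeR R) -> \bar R}) :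
  on_nneg sigma -> bounded_finite sigma -> sigma_finite setT sigma.
Proof.
move=> s0 sf; exists (fun n => `]-oo, n%:R]%classic).
  apply/esym/seteqP; split=> // x _; exists (Num.truncn x).+1 => //=.
  by rewrite in_itv /= ltW// truncnS_gt.
move=> n; split=> //.
apply: (@le_lt_trans _ _ (sigma `[0%R, n%:R]%classic)) => //.
rewrite (@itv_bndbnd_setU _ _ -oo%O (BLeft 0%R) (BRight n%:R)) ?bnd_simp//.
apply: (le_trans (measureU2 _ _ _)) => //.
by rewrite [X in X + _]s0 add0e.
Qed.

(** Packs [sigma] and the hypothesis of sigma-finiteness into the structure over which the product
    measure is formed. *)
Lemma tonelli_triangle (sigma : {measure set (measurableTypeR R) -> \bar R})
    (phi w : R -> R) :
  sigma_finite setT sigma ->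
  measurable_fun setT phi -> (forall t, 0 <= phi t)%R ->
  measurable_fun setT w -> (forall t, 0 <= w t)%R ->
  \int[leb]_(t in Rge0) ((phi t)%:E * \int[sigma]_(s in `[0%R, t]) (w s)%:E) =
  \int[sigma]_(s in Rge0) ((w s)%:E * \int[leb]_(t in `[s, +oo[) (phi t)%:E).
Proof.
move=> h.
pose H1 := isSFinite.Build _ _ _ _ (sfinite_measure_sigma_finite h).
pose H2 := isSigmaFinite.Build _ _ _ _ h.
pose m := HB.pack_for (SigmaFiniteMeasure.type (measurableTypeR R) R)
  (Measure.sort sigma) H1 H2.
have -> : sigma = m by exact: eq_measure.
exact: sigma_finite_tonelli_triangle.
Qed.

End tonelli.

(** * Absolutely continuous functions with almost everywhere vanishing derivative *)

Section zero_derivative.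
Context {R : realType}.
Local Notation leb := (@lebesgue_measure R).

(** Real induction. Let [c] be the supremum of the points of [[a, b]] satisfying [S]. The local step
    carries [S] from a point near [c] to points past [c], which is impossible unless [c = b]; in
    that case it yields [S b]. *)
Lemma cousin_ind (S : R -> Prop) (a b : R) : a <= b -> S a ->
  (forall c, a <= c <= b -> exists2 d : R, 0 < d & forall x y,
     a <= x <= c -> c <= y <= b -> c - d < x -> y < c + d -> S x -> S y) ->
  S b.
Proof.
move=> ab Sa step.
pose A := [set x | a <= x <= b /\ S x].
have Aa : A a by split=> //; rewrite lexx.
have ubA : ubound A b by move=> x [/andP[]].
have supA : has_sup A by split; [exists a|exists b].
have ac : a <= sup A by apply: sup_upper_bound.
have cb : sup A <= b by apply: ge_sup => //; exists a.
have [|d d0 H] := step (sup A); first by rewrite ac.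
have [x [/andP[ax xb] Sx] xc] := sup_adherent d0 supA.
have xs : x <= sup A by apply: sup_upper_bound => //; split=> //; rewrite ax.
pose y := Order.min b (sup A + d / 2).
have cy : sup A <= y by rewrite /y le_min cb lerDl divr_ge0// ltW.
have yb : y <= b by rewrite /y ge_min lexx.
have Sy : S y.
  apply: (H x) => //; first by rewrite ax.
  - by rewrite cy.
  - by rewrite /y gt_min ltrD2l; apply/orP; right; lra.
have yA : y <= sup A.
  by apply: sup_upper_bound => //; split=> //; rewrite yb (le_trans ac).
have : sup A + d / 2 <= sup A -> False by lra.
move: yA; rewrite /y ge_min => /orP[bs _|h /(_ h)//].
suff -> : b = y by [].
by apply/eqP; rewrite eq_le yb (le_trans bs).
Qed.

Lemma is_derive0_bound (g : R -> R) (c e : R) : is_derive c 1 g 0 -> 0 < e ->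
  exists2 d : R, 0 < d & forall y, `|y - c| < d -> `|g y - g c| <= e * `|y - c|.
Proof.
move=> [dg dg0] e0.
have : h^-1 *: ((g \o shift c) (h *: 1) - g c) @[h --> 0^'] --> 'D_1 g c.
  exact: dg.
rewrite dg0 => /cvgrPdist_le/(_ e e0).
rewrite near_withinE => /nbhs_ballP[d /= d0 H].
exists d => // y yd.
have [->|yc] := eqVneq y c; first by rewrite !subrr normr0 mulr0.
have := H (y - c); rewrite /ball /= sub0r normrN => /(_ yd).
rewrite subr_eq0 => /(_ yc).
rewrite [_ *: 1]mulr1 subrK sub0r normrN normrZ normfV.
by rewrite ler_pdivrMl ?normr_gt0 ?subr_eq0// mulrC.
Qed.

(** The list form lets an induction add one interval at a time. The list runs from right to left,
    and neighbours may touch, since only the open intervals must be disjoint. *)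
Lemma abs_continuous_seq (g : R -> R) (a b e : R) :
  abs_continuous_on a b g -> 0 < e ->
  exists2 d : R, 0 < d & forall s : seq (R * R),
    all (fun p => [&& a <= p.1, p.1 <= p.2 & p.2 <= b]) s ->
    pairwise (fun p q => q.2 <= p.1) s ->
    \sum_(p <- s) (p.2 - p.1) < d ->
    \sum_(p <- s) `|g p.2 - g p.1| < e.
Proof.
move=> acg e0; have [d d0 H] := acg e e0; exists d => // s alls pws sd.
pose F (i : 'I_(size s)) := nth (0, 0) s i.
rewrite (big_nth (0, 0)) big_mkord.
apply: (H _ (fun i => (F i).1) (fun i => (F i).2)).
- by move=> i; have /allP/(_ (F i)) := alls; rewrite mem_nth// => /(_ isT)/and3P[].
- apply/trivIsetP => i j _ _ ij; apply/seteqP; split=> // x [/=].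
  rewrite !in_itv /= => /andP[ui vi] /andP[uj vj].
  have /pairwiseP := pws => /(_ (0, 0)) pw.
  move: ij; rewrite neq_ltn => /orP[] ij.
    have := pw i j; rewrite !inE !ltn_ord => /(_ isT isT ij) h.
    by have := lt_trans (lt_le_trans vj h) ui; rewrite ltxx.
  have := pw j i; rewrite !inE !ltn_ord => /(_ isT isT ij) h.
  by have := lt_trans (lt_le_trans vi h) uj; rewrite ltxx.
- by rewrite (big_nth (0, 0)) big_mkord in sd.
Qed.

(* On intervals tagged outside [N] the increment of [g] is at most [e] times the
   length; those tagged in [N] lie in an open set [U] of measure less than [d],
   so absolute continuity bounds their total contribution by [e]. *)
Lemma abs_continuous_derive0 (g : R -> R) (N : set R) (a b : R) : a <= b ->
  abs_continuous_on a b g -> measurable N -> leb N = 0%E ->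
  (forall c, a <= c <= b -> ~ N c -> is_derive c 1 g 0) -> g a = g b.
Proof.
move=> ab acg mN N0 dg.
suff key (e : R) : 0 < e -> `|g b - g a| <= e * (b - a) + e.
  apply/esym/eqP; rewrite -subr_eq0 -normr_eq0; apply/eqP/le_anti.
  rewrite normr_ge0 andbT; apply/ler_addgt0Pl => e e0.
  have c0 : 0 < b - a + 1 by lra.
  (* With this constant the two error terms add up to exactly [e]. *)
  have := key (e / (b - a + 1)); rewrite divr_gt0// => /(_ isT).
  suff -> : e / (b - a + 1) * (b - a) + e / (b - a + 1) = e by rewrite addr0.
  by field; rewrite gt_eqF.
move=> e0.
have [d d0 acs] := abs_continuous_seq acg e0.
(* Outer regularity makes [U] minus [N] smaller than [d]; as [N] is null, the same holds for [U]. *)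
have [|U [oU NU Ud]] := lebesgue_regularity_outer mN _ d0.
  by rewrite [X in (X < _)%E]N0 ltry.
have mU : measurable U by apply: open_measurable.
have Ud' : (leb U < d%:E)%E.
  rewrite (_ : U = (U `\` N) `|` N); last by rewrite setUC setDUK.
  rewrite measureU//; last 2 first.
  - exact: measurableD.
  - by rewrite setIC setDIK.
  by rewrite [X in (_ + X)%E]N0 adde0.
(* [s] collects the steps taken across points of [N] up to [x]. Their total length is charged to the
   part of [U] in [[a, x[]; the other steps are paid for by [e * (x - a)]. *)
pose good x (s : seq (R * R)) := [/\
  all (fun p => [&& a <= p.1, p.1 <= p.2 & p.2 <= x]) s,
  pairwise (fun p q => q.2 <= p.1) s,
  ((\sum_(p <- s) (p.2 - p.1))%:E <= leb (U `&` `[a, x[))%E &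
  `|g x - g a| <= e * (x - a) + \sum_(p <- s) `|g p.2 - g p.1|].
have widen x y s : x <= y ->
    all (fun p => [&& a <= p.1, p.1 <= p.2 & p.2 <= x]) s ->
    all (fun p => [&& a <= p.1, p.1 <= p.2 & p.2 <= y]) s.
  move=> xy; apply: sub_all => p /and3P[-> -> /=].
  by move=> px; exact: le_trans px xy.
suff [s [alls pws sU gb]] : exists s, good b s.
  apply: (le_trans gb); rewrite lerD2l ltW//; apply: acs => //.
  rewrite -lte_fin; apply: (le_lt_trans sU); apply: le_lt_trans Ud'.
  by apply: le_measure; rewrite ?inE//; apply: measurableI.
apply: (@cousin_ind (fun x => exists s, good x s) a b) => //.
  exists [::]; split=> //; first by rewrite big_nil.
  by rewrite big_nil !subrr normr0 mulr0 addr0.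
(* If [c] is in [N], a step within a ball contained in [U] is added to the list. *)
move=> c cab; have [Nc|Nc] := pselect (N c).
  have /nbhs_ballP[r /= r0 rU] : nbhs c U by apply: open_nbhs_nbhs; split=> //; exact: NU.
  exists r => // x y /andP[ax xc] /andP[cy yb] xr yr [s [alls pws sU gx]].
  have xy : x <= y by exact: le_trans cy.
  have xyU : `[x, y[%classic `<=` U.
    move=> z /=; rewrite in_itv /= => /andP[xz zy]; apply: rU.
    by rewrite /ball /= ltr_norml; apply/andP; split; lra.
  exists ((x, y) :: s); split.
  - by rewrite /= ax xy lexx/=; exact: widen alls.
  - rewrite /= pws andbT; apply: sub_all alls => p /and3P[_ _ px] //.
  - rewrite big_cons /=.
    rewrite (_ : U `&` _ = (U `&` `[a, x[%classic) `|` `[x, y[%classic); last first.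
      rewrite (@itv_bndbnd_setU _ _ (BLeft a) (BLeft x) (BLeft y)) ?bnd_simp//.
      by rewrite setIUr (setIidr xyU).
    rewrite measureU//; last 2 first.
    + exact: measurableI.
    + apply/seteqP; split=> // z [[_ /=]]; rewrite !in_itv /=.
      by move=> /andP[_ zx] /andP[xz _]; have := lt_le_trans zx xz; rewrite ltxx.
    rewrite [X in (_ + X)%E]lebesgue_measure_itv /= lte_fin.
    rewrite EFinD addeC; apply: leeD => //.
    by case: ltP => // yx; rewrite lee_fin subr_le0.
  - rewrite big_cons /=.
    have -> : g y - g a = (g y - g x) + (g x - g a) by ring.
    apply: (le_trans (ler_normD _ _)); rewrite addrCA lerD2l.
    apply: (le_trans gx); rewrite lerD2r ler_pM2l//; lra.
(* Outside [N] the list is unchanged: the increment is split at [c], where the zero derivative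
   bounds both halves by [e] times their lengths. *)
have [r r0 Hr] := is_derive0_bound (dg c cab Nc) e0.
exists r => // x y /andP[ax xc] /andP[cy yb] xr yr [s [alls pws sU gx]].
have xy : x <= y by exact: le_trans cy.
exists s; split=> //; first exact: widen alls.
  apply: (le_trans sU); apply: le_measure; rewrite ?inE; [exact: measurableI..|].
  by apply: setIS; apply: subset_itvl; rewrite bnd_simp.
have hx : `|g x - g c| <= e * (c - x).
  have := Hr x; rewrite (ler0_norm (_ : x - c <= 0)) ?subr_le0// opprB; apply; lra.
have hy : `|g y - g c| <= e * (y - c).
  have := Hr y; rewrite (ger0_norm (_ : 0 <= y - c)) ?subr_ge0//; apply; lra.
have -> : g y - g a = (g y - g c) + (- (g x - g c) + (g x - g a)) by ring.
apply: (le_trans (ler_normD _ _)).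
have h2 := ler_normD (- (g x - g c)) (g x - g a).
rewrite normrN in h2.
have E : e * (y - a) = e * (y - c) + (e * (c - x) + e * (x - a)) by ring.
rewrite E; lra.
Qed.

Lemma locally_abs_continuous_derive0 (g : R -> R) :
  locally_abs_continuous g ->
  {ae leb, forall t : R, 0 < t -> is_derive t 1 g 0} ->
  forall s t : R, 0 < s -> 0 < t -> g s = g t.
Proof.
move=> lac [N [mN N0 sub]].
have H s t : 0 < s -> s <= t -> g s = g t.
  move=> s0 st; apply: (@abs_continuous_derive0 g N s t) => //; first exact: lac.
  move=> c /andP[sc _] Nc; apply: contrapT => h; apply: Nc; apply: sub => /=.
  by move=> /(_ (lt_le_trans s0 sc)).
move=> s t s0 t0; have [st|ts] := leP s t; first exact: H.
by apply/esym/H => //; exact: ltW.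
Qed.

End zero_derivative.

(** * Distribution functions and their Laplace transforms *)

Section distribution_function.
Context {R : realType}.
Local Notation leb := (@lebesgue_measure R).
Local Notation Rge0 := `[0%R, +oo[%classic.
Implicit Types sigma nu : {measure set (measurableTypeR R) -> \bar R}.

(** [fine] loses nothing once [sigma] is finite on bounded intervals. For [t < 0] the interval is
    empty and the value is [0], so monotonicity holds on the whole line. *)
Definition distr sigma (t : R) : R := fine (sigma `[0%R, t]%classic).

Lemma distr_ge0 sigma t : 0 <= distr sigma t.
Proof. by rewrite fine_ge0. Qed.

Lemma EFin_distr sigma t : bounded_finite sigma ->
  (distr sigma t)%:E = sigma `[0%R, t]%classic.
Proof. by move=> sf; rewrite fineK// ge0_fin_numE. Qed.

Lemma distr_nondecreasing sigma : bounded_finite sigma ->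
  nondecreasing_fun (distr sigma).
Proof.
move=> sf s t st; rewrite -lee_fin !EFin_distr//.
by apply: le_measure; rewrite ?inE//; apply: subset_itvl; rewrite bnd_simp.
Qed.

Lemma measurable_distr sigma (D : set R) : bounded_finite sigma ->
  measurable D -> measurable_fun D (distr sigma).
Proof.
by move=> sf mD; apply: nondecreasing_measurable => //; exact: distr_nondecreasing.
Qed.

(** On [[0, t]] the exponential [e^(-s)] is at least [e^(-t)], so [e^(-t) sigma([0, t])] is at most
    the transform of [sigma] at [1]. *)
Lemma in_A0_bounded_finite sigma : in_A0 sigma -> bounded_finite sigma.
Proof.
move=> [s0 fin] t.
have mf (D : set (measurableTypeR R)) :
    measurable_fun D (fun s : R => (expR (- (1 * s)))%:E).
  by apply/measurable_EFinP; exact: measurable_expRN.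
have : (\int[sigma]_(s in `[0%R, t]) (expR (- t))%:E < +oo)%E.
  apply: le_lt_trans (fin 1 ltr01).
  apply: (@le_trans _ _ (\int[sigma]_(s in `[0%R, t]) (expR (- (1 * s)))%:E)%E).
    apply: ge0_le_integral => //.
    by move=> s /=; rewrite in_itv /= => /andP[_ st]; rewrite lee_fin ler_expR mul1r lerN2.
  apply: ge0_subset_integral => //.
  by apply: subset_itvl; rewrite bnd_simp.
rewrite integral_cst// => h.
have : ((expR t)%:E * ((expR (- t))%:E * sigma `[0%R, t]%classic) < +oo)%E.
  by rewrite lte_mul_pinfty// ?lee_fin ?expR_ge0.
by rewrite muleA -EFinM -expRD subrr expR0 mul1e.
Qed.

Lemma integral_expRN (x s : R) : 0 < x ->
  (\int[leb]_(t in `[s, +oo[) (x * expR (- (x * t)))%:E = (expR (- (x * s)))%:E)%E.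
Proof.
move=> x0.
have dl (t : R) : is_derive t 1 (fun t : R => - (x * t)) (- x).
  rewrite (_ : (fun t : R => _) = (- x) \*: id); last first.
    by apply/funext => z; rewrite /= /GRing.scale /= mulNr.
  apply: (is_derive_eq (is_deriveZ (- x) (is_derive_id t 1))).
  by rewrite /GRing.scale /= mulr1.
have de (t : R) : is_derive t 1 (fun t : R => expR (- (x * t)))
    (- x * expR (- (x * t))).
  by apply: (is_derive_eq (is_derive1_comp (is_derive_expR _) (dl t))); rewrite mulrC.
have ce : continuous (fun t : R => expR (- (x * t))).
  move=> t; have [d _] := de t; exact/differentiable_continuous/derivable1_diffP.
have dF (t : R) : is_derive t 1 (fun t : R => - expR (- (x * t)))
    (x * expR (- (x * t))).
  by apply: (is_derive_eq (is_deriveN (de t))); rewrite mulNr opprK.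
rewrite (@ge0_continuous_FTC2y _ _ (fun t => - expR (- (x * t))) s 0).
- by rewrite EFinN oppeK add0e.
- by move=> t _; rewrite mulr_ge0 ?expR_ge0// ltW.
- apply: continuous_subspaceT => t.
  by apply: cvgM; [exact: cvg_cst|exact: ce].
- rewrite -oppr0; apply: cvgN.
  apply: (@cvg_comp _ _ _ (fun z => x * z) (fun z => expR (- z)) _ (pinfty_nbhs R)).
    exact: gt0_cvgMry.
  exact: cvgr_expR.
- by move=> t _; have [] := dF t.
- by apply: cvgN; apply: cvg_at_right_filter; exact: ce.
- by move=> t _; rewrite derive1E; have [_ ->] := dF t.
Qed.

(* Integration by parts in Tonelli form, so that no boundary terms appear. *)
Lemma laplace_of_primitive sigma (w : R -> R) (x : R) :
  sigma_finite setT sigma ->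
  measurable_fun setT w -> (forall t, 0 <= w t) -> 0 < x ->
  (\int[leb]_(t in Rge0)
     ((x * expR (- (x * t)))%:E * \int[sigma]_(s in `[0%R, t]) (w s)%:E) =
   \int[sigma]_(s in Rge0) (expR (- (x * s)) * w s)%:E)%E.
Proof.
move=> sf mw w0 x0.
rewrite (tonelli_triangle (phi := fun t => x * expR (- (x * t))) sf)//.
- by apply: eq_integral => s _; rewrite integral_expRN// -EFinM mulrC.
- by apply: measurable_funM => //; exact: measurable_expRN.
- by move=> t; rewrite mulr_ge0 ?expR_ge0// ltW.
Qed.

(** The case [w = 1] of [laplace_of_primitive], since integrating [1] over [[0, t]] against [sigma]
    gives [distr sigma t]. *)
Lemma laplace_of_distr sigma (x : R) :
  on_nneg sigma -> bounded_finite sigma -> 0 < x ->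
  (\int[leb]_(t in Rge0) ((x * expR (- (x * t))) * distr sigma t)%:E =
   \int[sigma]_(s in Rge0) (expR (- (x * s)))%:E)%E.
Proof.
move=> s0 sf x0; have := laplace_of_primitive (w := cst 1) (sigma_finite_nneg s0 sf).
move=> /(_ x (measurable_cst _) (fun=> ler01) x0) => H.
under [RHS]eq_integral do rewrite -[expR _]mulr1.
rewrite -{}H; apply: eq_integral => t _.
rewrite EFinM EFin_distr//; congr (_ * _)%E; rewrite -[LHS]mul1e.
by rewrite -(integral_cst sigma (measurable_itv `[0%R, t]) 1%E).
Qed.

(** The transform of [distr sigma] at [x] is [1 / x] times that of [sigma], hence finite. *)
Lemma has_laplace_distr sigma : in_A0 sigma -> has_laplace leb (distr sigma).
Proof.
move=> As; have sf := in_A0_bounded_finite As; have [s0 fin] := As.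
apply: has_laplaceP.
- exact: measurable_distr.
- by move=> t _; exact: distr_ge0.
move=> x x0; have := fin x x0; rewrite -(laplace_of_distr s0 sf x0).
under eq_integral do rewrite -mulrA EFinM.
rewrite ge0_integralZl_EFin ?(ltW x0)//; last 2 first.
- by move=> t _; rewrite lee_fin mulr_ge0 ?expR_ge0 ?distr_ge0.
- apply/measurable_EFinP; apply: measurable_funM; first exact: measurable_expRN.
  exact: measurable_distr.
move=> h; have : ((x^-1)%:E * (x%:E * \int[leb]_(t in Rge0)
    (expR (- (x * t)) * distr sigma t)%:E) < +oo)%E.
  by rewrite lte_mul_pinfty// lee_fin invr_ge0 ltW.
by rewrite muleA -EFinM mulVf ?gt_eqF// mul1e.
Qed.

(** The numerator [distr sigma u] is nondecreasing and the denominator is at least [a^i]. With [y]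
    the [i]th derivative of [p] at [u], this controls the derivatives away from the origin. *)
Lemma distr_bound sigma (i : nat) (a b u y : R) :
  bounded_finite sigma -> 0 < a -> a <= u -> u <= b ->
  u ^+ i * y = distr sigma u -> `|y| <= distr sigma b / a ^+ i.
Proof.
move=> sf a0 au ub E; have u0 := lt_le_trans a0 au.
have -> : y = distr sigma u / u ^+ i.
  by rewrite -E mulrAC mulfV ?mul1r// expf_neq0// gt_eqF.
rewrite ger0_norm ?divr_ge0 ?distr_ge0 ?exprn_ge0 ?(ltW u0)//.
apply: ler_pM; rewrite ?distr_ge0 ?invr_ge0 ?exprn_ge0 ?(ltW u0)//.
  exact: distr_nondecreasing.
by rewrite lef_pV2 ?posrE ?exprn_gt0// lerXn2r// nnegrE ltW.
Qed.

End distribution_function.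

(** * Integration by parts for [t * distr sigma t] *)

Section mul_distr.
Context {R : realType}.
Local Notation leb := (@lebesgue_measure R).
Local Notation Rge0 := `[0%R, +oo[%classic.
Implicit Types sigma nu : {measure set (measurableTypeR R) -> \bar R}.
Local Open Scope ereal_scope.

(** Tonelli with [w = 1] and [phi] the indicator of [[0, t]] turns the integral of [distr sigma]
    into that of [t - s] against [sigma]; adding the integral of [s] leaves [t sigma([0, t])]. *)
Lemma integral_id_distr sigma (t : R) :
  on_nneg sigma -> bounded_finite sigma -> (0 <= t)%R ->
  \int[sigma]_(s in `[0%R, t]) s%:E + \int[leb]_(s in `[0%R, t]) (distr sigma s)%:E
  = (t * distr sigma t)%:E.
Proof.
move=> s0 sf t0.
have m1 : measurable_fun setT (\1_(`[0%R, t]%classic) : R -> R).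
  exact: measurable_indic.
have := tonelli_triangle (phi := \1_(`[0%R, t]%classic)) (w := cst 1%R)
  (sigma_finite_nneg s0 sf).
have i0 (s : R) : (0 <= \1_(`[0%R, t]%classic) s :> R)%R by rewrite indicE.
move=> /(_ m1 i0 (measurable_cst _) (fun=> ler01)).
have -> : \int[leb]_(r in Rge0) ((\1_(`[0%R, t]%classic) r)%:E *
      \int[sigma]_(s in `[0%R, r]) (cst 1%R s)%:E) =
    \int[leb]_(s in `[0%R, t]) (distr sigma s)%:E.
  transitivity (\int[leb]_(r in Rge0 `&` `[0%R, t]) (distr sigma r)%:E).
    rewrite integral_mkcondr; apply: eq_integral => r _.
    rewrite indicE patchE EFin_distr//; case: ifPn => _; last exact: mul0e.
    by rewrite mul1e -[RHS]mul1e -(integral_cst sigma (measurable_itv `[0%R, r]) 1).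
  by congr (integral _ _ _); rewrite setIidr//; apply: subset_itvl; rewrite bnd_simp.
move=> ->.
have -> : \int[sigma]_(s in Rge0) ((cst 1%R s)%:E *
      \int[leb]_(r in `[s, +oo[) (\1_(`[0%R, t]%classic) r)%:E) =
    \int[sigma]_(s in `[0%R, t]) (t - s)%:E.
  transitivity (\int[sigma]_(r in Rge0 `&` `[0%R, t]) (t - r)%:E).
    rewrite integral_mkcondr; apply: eq_integral => s.
    rewrite mem_setE in_itv /= andbT => sge0.
    rewrite mul1e integral_indic//.
    have -> : `[0%R, t]%classic `&` `[s, +oo[ = `[s, t]%classic.
      apply/seteqP; split=> r /=; rewrite !in_itv /= andbT.
        by move=> [/andP[_ ->] ->].
      by move=> /andP[sr ->]; rewrite sr (le_trans sge0).
    rewrite [LHS]lebesgue_measure_itv /= lte_fin patchE mem_setE in_itv /= sge0 /=.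
    by case: ltgtP => // ->; rewrite subrr.
  by congr (integral _ _ _); rewrite setIidr//; apply: subset_itvl; rewrite bnd_simp.
rewrite -ge0_integralD//.
- transitivity (\int[sigma]_(s in `[0%R, t]) cst t%:E s).
    by apply: eq_integral => s _; rewrite -EFinD addrC subrK.
  by rewrite integral_cst// EFinM EFin_distr.
- by move=> s /=; rewrite in_itv /= lee_fin => /andP[].
- by move=> s /=; rewrite in_itv /= lee_fin subr_ge0 => /andP[].
- by apply/measurable_EFinP; exact: measurable_funB.
Qed.

(** Eliminates the integral of [s] against [sigma] between the formula for [nu] on [[0, t]] and
    [integral_id_distr], which raises the coefficient from [c] to [c + 1]. *)
Lemma weighted_difference_primitive (c : R) sigma nu (t : R) :
  on_nneg sigma -> bounded_finite sigma -> (0 <= c)%R ->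
  is_weighted_difference c sigma nu -> (0 <= t)%R ->
  (t * distr sigma t)%:E = nu `[0%R, t]%classic +
    (c + 1)%:E * \int[leb]_(s in `[0%R, t]) (distr sigma s)%:E.
Proof.
move=> s0 sf c0 [_ H] t0.
have Ab := integral_id_distr s0 sf t0.
rewrite (H t `[0%R, t]%classic)//.
rewrite (_ : \int[leb]_(s in `[0%R, t]) sigma `[0%R, s]%classic =
    \int[leb]_(s in `[0%R, t]) (distr sigma s)%:E); last first.
  by apply: eq_integral => s _; rewrite EFin_distr.
move: Ab; set A := \int[sigma]_(s in _) _; set B := \int[leb]_(s in _) _.
have A0 : 0 <= A.
  by apply: integral_ge0 => s /=; rewrite in_itv /= lee_fin => /andP[].
have B0 : 0 <= B by apply: integral_ge0 => s _; rewrite lee_fin distr_ge0.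
(* Two nonnegative terms with a finite sum are finite, so an identity between reals remains. *)
case: A A0 => [a| |]//; case: B B0 => [b| |]// _ _ <-.
rewrite -!EFinM -!EFinN -!EFinD; congr (_%:E); ring.
Qed.

End mul_distr.

(** * Criteria for absolute continuity and recovery of a function from its almost everywhere
    derivative *)

Section absolutely_continuous_primitive.
Context {R : realType}.
Local Notation leb := (@lebesgue_measure R).
Implicit Types f g h K : R -> R.

(** A single comparison principle that serves for differences, products and Lipschitz functions. *)
Lemma abs_continuous_dominated (a b A B : R) f g h :
  0 <= A -> 0 <= B ->
  abs_continuous_on a b f -> abs_continuous_on a b g ->
  (forall u v, a <= u -> u <= v -> v <= b ->
     `|h v - h u| <= A * `|f v - f u| + B * `|g v - g u|) ->
  abs_continuous_on a b h.
Proof.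
move=> A0 B0 acf acg H e e0.
have ltr02 : 0 < 2 :> R by [].
have A10 : 0 < A + 1 by rewrite ltr_pwDr.
have B10 : 0 < B + 1 by rewrite ltr_pwDr.
(* The denominators [A + 1] and [B + 1] stay positive when [A] or [B] is zero and keep each share
   strictly below [e / 2]. *)
have [d1 d10 H1] := acf (e / 2 / (A + 1)) (divr_gt0 (divr_gt0 e0 ltr02) A10).
have [d2 d20 H2] := acg (e / 2 / (B + 1)) (divr_gt0 (divr_gt0 e0 ltr02) B10).
exists (Order.min d1 d2); first by rewrite lt_min d10.
move=> n u v uv tuv; rewrite lt_min => /andP[s1 s2].
have {}H1 := H1 n u v uv tuv s1; have {}H2 := H2 n u v uv tuv s2.
apply: (@le_lt_trans _ _ (A * (\sum_(i < n) `|f (v i) - f (u i)|) +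
    B * (\sum_(i < n) `|g (v i) - g (u i)|))).
  rewrite !mulr_sumr -big_split /=; apply: ler_sum => i _.
  by have [au [uv' vb]] := uv i; exact: H.
have h1 : A * (\sum_(i < n) `|f (v i) - f (u i)|) <= A * (e / 2 / (A + 1)).
  by rewrite ler_wpM2l// ltW.
have h2 : B * (\sum_(i < n) `|g (v i) - g (u i)|) <= B * (e / 2 / (B + 1)).
  by rewrite ler_wpM2l// ltW.
have h3 (C : R) : 0 <= C -> C * (e / 2 / (C + 1)) < e / 2.
  move=> C0; have C10 : 0 < C + 1 by rewrite ltr_pwDr.
  rewrite mulrCA gtr_pMr ?divr_gt0// ltr_pdivrMr// mul1r; lra.
have := h3 _ A0; have := h3 _ B0; lra.
Qed.

Lemma abs_continuous_id (a b : R) : abs_continuous_on a b id.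
Proof.
move=> e e0; exists e => // n u v uv _; congr (_ < _).
by apply: eq_bigr => i _; have [_ [h _]] := uv i; rewrite ger0_norm// subr_ge0.
Qed.

Lemma abs_continuous_lipschitz (a b A : R) h : 0 <= A ->
  (forall u v, a <= u -> u <= v -> v <= b -> `|h v - h u| <= A * (v - u)) ->
  abs_continuous_on a b h.
Proof.
move=> A0 H; apply: (@abs_continuous_dominated a b A 0 id id) => //.
- exact: abs_continuous_id.
- exact: abs_continuous_id.
move=> u v au uv vb; rewrite mul0r addr0 (@ger0_norm _ (id v - id u)) ?subr_ge0//.
exact: H.
Qed.

(** The values on the interval lie between [0] and [h v]. The flag [b] makes the left end closed or
    open; both occur below. *)
Lemma nondecreasing_integrable h (u v : R) (b : bool) : nondecreasing_fun h ->
  (forall t, 0 <= h t) ->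
  leb.-integrable [set` Interval (BSide b u) (BRight v)] (EFin \o h).
Proof.
move=> nh h0; apply: measurable_bounded_integrable => //.
- rewrite [ltLHS]lebesgue_measure_itv /=; case: ifP => // _.
  by rewrite -EFinB ltry.
- exact: nondecreasing_measurable.
exists (h v); split; first exact: num_real.
move=> M hM t /=; rewrite itv_boundlr => /andP[_]; rewrite bnd_simp => tv.
by rewrite ger0_norm// (le_trans (nh _ _ tv))// ltW.
Qed.

Lemma nondecreasing_locally_integrable h : nondecreasing_fun h ->
  (forall t, 0 <= h t) -> locally_integrable [set: R] h.
Proof.
move=> nh h0; split; [exact: nondecreasing_measurable|exact: openT|].
move=> K _ cK; have [M [_ KM]] := compact_bounded cK.
pose N := `|M| + 1; have KN : K `<=` `[- N, N]%classic.
  move=> t Kt; rewrite /= in_itv /= -ler_norml; apply: KM => //.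
  by rewrite /N; have := ler_norm M; lra.
have mh (D : set R) : measurable D -> measurable_fun D (fun t => `|h t|%:E).
  move=> mD; apply/measurable_EFinP; apply: measurableT_comp => //.
  exact: nondecreasing_measurable.
have /integrableP[_] := nondecreasing_integrable (- N) N true nh h0.
apply: le_lt_trans; apply: ge0_subset_integral => //.
- exact: compact_measurable.
- exact: mh.
Qed.

Lemma expr_lipschitz (n : nat) (b : R) : 0 <= b ->
  exists2 B : R, 0 <= B & forall u v, 0 <= u -> u <= v -> v <= b ->
    `|v ^+ n - u ^+ n| <= B * (v - u).
Proof.
move=> b0; elim: n => [|n [B B0 IH]].
  exists 0 => // u v _ _ _; by rewrite subrr normr0 mul0r.
exists (b * B + b ^+ n) => [|u v u0 uv vb].
  by rewrite addr_ge0 ?mulr_ge0 ?exprn_ge0.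
have v0 := le_trans u0 uv.
rewrite !exprS.
have -> : v * v ^+ n - u * u ^+ n = v * (v ^+ n - u ^+ n) + u ^+ n * (v - u) by ring.
apply: (le_trans (ler_normD _ _)); rewrite mulrDl !normrM.
rewrite (ger0_norm v0) (ger0_norm (exprn_ge0 _ u0)) (@ger0_norm _ (v - u)) ?subr_ge0//.
apply: lerD; last first.
  by rewrite ler_wpM2r ?subr_ge0// lerXn2r ?nnegrE// (le_trans uv).
by rewrite -mulrA; apply: ler_pM => //; exact: IH.
Qed.

(* [K 0] is irrelevant: the linear bound on [(0, 1]] replaces continuity at 0. *)
Lemma primitive_of_ae_derivative K h (C : R) :
  locally_abs_continuous K -> nondecreasing_fun h -> (forall t, 0 <= h t) ->
  {ae leb, forall t : R, 0 < t -> is_derive t 1 K (h t)} ->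
  (forall t, 0 < t <= 1 -> `|K t| <= C * t) ->
  forall t, 0 < t -> (K t)%:E = (\int[leb]_(s in `[0%R, t]) (h s)%:E)%E.
Proof.
move=> acK nh h0 dK K0 t t0.
pose F x := \int[leb]_(s in `[0, x]) h s.
have ih u v b := nondecreasing_integrable u v b nh h0.
(* This bound serves twice: for the absolute continuity of [F] and for its smallness near the
   origin. *)
have FB u v : 0 <= u -> u <= v -> 0 <= F v - F u <= h v * (v - u).
  move=> u0 uv.
  rewrite /F (Rintegral_itvB (ih 0 v true)) ?bnd_simp//.
  apply/andP; split; first by apply: Rintegral_ge0.
  have -> : h v * (v - u) = \int[leb]_(s in `]u, v]) (cst (h v) s).
    rewrite Rintegral_cst//; congr (_ * _).
    rewrite [X in fine X]lebesgue_measure_itv /= lte_fin.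
    by case: ltgtP uv => //= -> _; rewrite subrr.
  apply: le_Rintegral => //.
  - by apply: (@nondecreasing_integrable (cst (h v)) u v false) => *; rewrite /= ?lexx ?h0.
  - by move=> s /=; rewrite in_itv /= => /andP[_ sv]; exact: nh.
have acD : locally_abs_continuous (K - F).
  move=> a b a0 ab.
  apply: (@abs_continuous_dominated a b 1 (h b) K id) => //.
  - exact: acK.
  - exact: abs_continuous_id.
  move=> u v au uv vb; rewrite mul1r.
  have -> : (K - F) v - (K - F) u = (K v - K u) - (F v - F u).
    by rewrite !fctE; ring.
  apply: (le_trans (ler_normB _ _)); rewrite lerD2l.
  have /andP[F0 F1] := FB u v (le_trans (ltW a0) au) uv.
  rewrite ger0_norm// (le_trans F1)// ger0_norm ?subr_ge0//.
  by rewrite ler_wpM2r ?subr_ge0//; exact: nh.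
(* By Lebesgue differentiation [F] has derivative [h] almost everywhere on the positive axis, so
   [K - F] has derivative zero almost everywhere and is constant there. *)
have dF := @FTC1 R h (BLeft 0) (fun y => ih 0 y true)
  (nondecreasing_locally_integrable nh h0).
have dD : {ae leb, forall s : R, 0 < s -> is_derive s 1 (K - F) 0}.
  apply: (@filterS2 _ _ (ae_filter_ringOfSetsType leb) _ _ _ _ dK dF) => s dKs dFs s0.
  case: dFs => [|dF1 dF2]; first by rewrite /= lte_fin.
  have dF' : is_derive s 1 F (h s) by split; rewrite // -derive1E.
  by apply: (is_derive_eq (is_deriveB (dKs s0) dF')); rewrite subrr.
have cst_D := locally_abs_continuous_derive0 acD dD.
(* The constant value of [K - F] can be read off at any small [s], where both terms are at most a
   multiple of [s]; letting [s] tend to [0] shows that it is zero. *)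
have D0 s : 0 < s <= 1 -> `|K t - F t| <= (C + h 1) * s.
  move=> /andP[s0 s1].
  have -> : K t - F t = K s - F s by exact: (cst_D t s t0 s0).
  apply: (le_trans (ler_normB _ _)); rewrite mulrDl; apply: lerD.
    by apply: K0; rewrite s0.
  have F00 : F 0 = 0 by rewrite /F set_itv1 Rintegral_set1.
  have /andP[] := FB 0 s (lexx _) (ltW s0); rewrite F00 !subr0 => Fs Fs'.
  by rewrite ger0_norm// (le_trans Fs')// ler_wpM2r ?(ltW s0)//; exact: nh.
have E : K t = F t.
  apply/eqP; rewrite -subr_eq0 -normr_le0; apply/ler_addgt0Pl => e e0.
  rewrite addr0.
  have c0 : 0 < `|C + h 1| + 1 by rewrite ltr_pwDr.
  pose s := Order.min 1 (e / (`|C + h 1| + 1)).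
  have s0 : 0 < s by rewrite /s lt_min ltr01 divr_gt0.
  apply: (le_trans (D0 s _)); first by rewrite s0 /s ge_min lexx.
  apply: (@le_trans _ _ ((`|C + h 1| + 1) * s)).
    by rewrite ler_wpM2r ?(ltW s0)//; have := ler_norm (C + h 1); lra.
  by rewrite -ler_pdivlMl// mulrC /s ge_min lexx orbT.
rewrite E /F /Rintegral fineK//.
by have /integrable_fin_num := ih 0 t true; exact.
Qed.

End absolutely_continuous_primitive.

(** * The primitive property for consecutive derivatives: [q] stands for [p^(j)], [sigma] for
    [mu_j], [tau] for [mu_(j+1)] *)

Section primitive_step.
Context {R : realType}.
Local Notation leb := (@lebesgue_measure R).
Variables (q : R -> R) (j : nat).
Variables sigma tau : {measure set (measurableTypeR R) -> \bar R}.
Hypothesis sf : bounded_finite sigma.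
Hypothesis tf : bounded_finite tau.

(** By the mean value theorem, since [distr tau t / t^(j+1)], the derivative of [q], is bounded on
    [[a, b]]. *)
Lemma derivable_locally_abs_continuous :
  (forall t, 0 < t -> derivable q t 1) ->
  (forall t, 0 < t -> t ^+ j.+1 * derive1 q t = distr tau t) ->
  locally_abs_continuous q.
Proof.
move=> dq Eq a b a0 ab.
have B0 : 0 <= distr tau b / a ^+ j.+1.
  by rewrite divr_ge0 ?distr_ge0 ?exprn_ge0 ?(ltW a0).
apply: (abs_continuous_lipschitz B0) => u v au; rewrite le_eqVlt.
move=> /predU1P[->|uv] vb; first by rewrite !subrr normr0 mulr0.
have pos x : u <= x -> 0 < x by move=> ux; rewrite (lt_le_trans a0)// (le_trans au).
have [c] : exists2 c, c \in `]u, v[ & q v - q u = derive1 q c * (v - u).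
  apply: MVT => //.
    move=> x; rewrite in_itv /= => /andP[ux _].
    by split; [exact/dq/pos/ltW|rewrite derive1E].
  apply: derivable_within_continuous => x; rewrite in_itv /= => /andP[ux _].
  exact/dq/pos.
rewrite in_itv /= => /andP[uc cv] ->; rewrite normrM.
rewrite (@ger0_norm _ (v - u)) ?subr_ge0 ?(ltW uv)// ler_wpM2r ?subr_ge0 ?(ltW uv)//.
apply: (@distr_bound _ tau j.+1 a b c) => //.
- by rewrite (le_trans au)// ltW.
- by rewrite (le_trans (ltW cv)).
- exact/Eq/pos/ltW.
Qed.

(** Rests on [primitive_of_ae_derivative] for [K(t) = t^(j+1) q(t)], which is [t * distr sigma t]
    for [t > 0]. The product rule gives the integrand as its derivative almost everywhere, and
    monotonicity gives [K(t) <= distr sigma 1 * t] on [(0, 1]]. *)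
Lemma mul_distr_primitive : locally_abs_continuous q ->
  (forall t, 0 < t -> t ^+ j * q t = distr sigma t) ->
  {ae leb, forall t : R, 0 < t ->
     derivable q t 1 /\ t ^+ j.+1 * derive1 q t = distr tau t} ->
  forall t : R, 0 <= t -> (t * distr sigma t)%:E =
    (\int[leb]_(s in `[0%R, t]) (distr tau s + j.+1%:R * distr sigma s)%:E)%E.
Proof.
move=> acq Eq dq t; rewrite le_eqVlt => /predU1P[<-|t0].
  by rewrite mul0r set_itv1 integral_set1.
pose K (t : R) := t ^+ j.+1 * q t.
have KE s : 0 < s -> K s = s * distr sigma s.
  by move=> s0; rewrite /K exprS -mulrA Eq.
rewrite -KE//.
apply: (@primitive_of_ae_derivative _ K
  (fun s => distr tau s + j.+1%:R * distr sigma s) (distr sigma 1)) => //.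
(* The product [K] is absolutely continuous on [[a, b]]: there [t^(j+1)] is Lipschitz and bounded,
   and [q] is bounded and absolutely continuous. *)
- move=> a b a0 ab; have b0 := le_trans (ltW a0) ab.
  have [B B0 HB] := expr_lipschitz j.+1 b0.
  have C0 : 0 <= B * (distr sigma b / a ^+ j).
    by rewrite mulr_ge0 ?divr_ge0 ?distr_ge0 ?exprn_ge0 ?(ltW a0).
  apply: (abs_continuous_dominated (exprn_ge0 j.+1 b0) C0 (acq _ _ a0 ab)
    (@abs_continuous_id _ a b)) => u v au uv vb.
  have u0 := lt_le_trans a0 au; have v0 := lt_le_trans u0 uv.
  have -> : K v - K u = v ^+ j.+1 * (q v - q u) + (v ^+ j.+1 - u ^+ j.+1) * q u.
    by rewrite /K; ring.
  apply: (le_trans (ler_normD _ _)); rewrite !normrM; apply: lerD.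
    rewrite ler_wpM2r// ger0_norm ?exprn_ge0 ?(ltW v0)//.
    by rewrite lerXn2r// nnegrE ltW.
  rewrite (@ger0_norm _ (id v - id u)) ?subr_ge0// mulrAC.
  apply: ler_pM => //; first exact: HB (ltW u0) uv vb.
  apply: (@distr_bound _ sigma j a b u) => //; first exact: le_trans vb.
  exact: Eq.
- move=> s s' ss; apply: lerD; first exact: distr_nondecreasing.
  by rewrite ler_wpM2l//; exact: distr_nondecreasing.
- by move=> s; rewrite addr_ge0 ?mulr_ge0 ?distr_ge0.
- apply: (@filterS _ _ (ae_filter_ringOfSetsType leb) _ _ _ dq) => s dqs s0.
  have [dqs1 dqs2] := dqs s0.
  have dq' : is_derive (s : R) 1 q (derive1 q s) by split; rewrite // derive1E.
  have dX : is_derive (s : R) 1 (fun s : R => s ^+ j.+1) (j.+1%:R * s ^+ j).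
    rewrite (_ : (fun s : R => _) = id ^+ j.+1); last first.
      by apply/funext => y; rewrite exprfctE.
    apply: (is_derive_eq (is_deriveX j.+1 (is_derive_id (s : R) 1))).
    by rewrite /GRing.scale /= mulr1.
  apply: (is_derive_eq (is_deriveM dX dq')).
  by rewrite /GRing.scale /= dqs2 -(Eq _ s0); ring.
- move=> s /andP[s0 s1]; rewrite KE// ger0_norm ?mulr_ge0 ?distr_ge0 ?(ltW s0)//.
  by rewrite mulrC ler_wpM2r ?(ltW s0)//; exact: distr_nondecreasing.
Qed.

End primitive_step.

(** * One step of the recursion for the Laplace transforms *)

Section laplace_recursion.
Context {R : realType}.
Local Notation leb := (@lebesgue_measure R).
Local Notation Rge0 := `[0%R, +oo[%classic.
Implicit Types sigma tau nu : {measure set (measurableTypeR R) -> \bar R}.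

(** Meant for [u = x^j f] and [w = distr (mu j)]. The first Leibniz term contains the derivative of
    the transform of [w], the second the transform itself. *)
Lemma derive1n_id_mul_laplace (u w : R -> R) (j : nat) : smooth_pos u ->
  has_laplace leb w ->
  (forall x, 0 < x -> derive1n j u x = (-1) ^+ j * laplace leb w x) ->
  forall x, 0 < x -> (-1) ^+ j.+1 * derive1n j.+1 (fun y => y * u y) x =
    x * laplace leb (fun t => t * w t) x - j.+1%:R * laplace leb w x.
Proof.
move=> su hw Eu x x0; have [_ ->//] := leibniz_id_mul su.
rewrite [j.+1.-1]/= Eu// derive1nS -(derive1n1 (derive1n j u)).
rewrite (@eq_derive1n_pos _ _ (fun x => (-1) ^+ j * laplace leb w x) Eu 1)//.
rewrite derive1n1 derive1E.
have d := is_deriveZ ((-1) ^+ j) (is_derive_laplace hw x0).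
have [_ ->] := d.
have s1 : (-1) ^+ j * (-1) ^+ j = 1 :> R.
  by rewrite -expr2 sqrr_sign.
rewrite /GRing.scale /= exprS.
(* The sign [(-1)^j] enters twice, as prefactor and through [Eu]; splitting off its square leaves a
   ring identity. *)
transitivity (((-1) ^+ j * (-1) ^+ j) * (x * laplace leb (fun t => t * w t) x
    - j.+1%:R * laplace leb w x)); last by rewrite s1 mul1r.
ring.
Qed.

Lemma EFin_mul_laplace (w : R -> R) (x : R) : has_laplace leb w -> 0 < x ->
  (x * laplace leb w x)%:E =
  (\int[leb]_(t in Rge0) (x * expR (- (x * t)) * w t)%:E)%E.
Proof.
move=> hw x0; rewrite EFinM EFin_laplace//.
have [mw w0 _] := hw.
under [in RHS]eq_integral do rewrite -mulrA EFinM.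
rewrite ge0_integralZl_EFin ?(ltW x0)//.
- move=> t /=; rewrite in_itv /= andbT => t0.
  by rewrite lee_fin mulr_ge0 ?expR_ge0 ?w0.
- apply/measurable_EFinP; apply: measurable_funM => //; exact: measurable_expRN.
Qed.

(** From [laplace_of_primitive] for Lebesgue measure. The equality of extended integrals passes
    finiteness on from [K] to [w]. *)
Lemma laplace_primitive (K w : R -> R) (x : R) : has_laplace leb K ->
  measurable_fun setT w -> (forall t, 0 <= w t) ->
  (forall t, 0 <= t -> (K t)%:E = (\int[leb]_(s in `[0%R, t]) (w s)%:E)%E) ->
  0 < x -> x * laplace leb K x = laplace leb w x.
Proof.
move=> hK mw w0 EK x0.
have H := laplace_of_primitive (sigma_finiteT leb) mw w0 x0.
have E : (\int[leb]_(t in Rge0) (x * expR (- (x * t)) * K t)%:E =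
    \int[leb]_(t in Rge0) (expR (- (x * t)) * w t)%:E)%E.
  rewrite -H; apply: eq_integral => t; rewrite mem_setE in_itv /= andbT => t0.
  by rewrite EFinM EK.
apply: EFin_inj; rewrite EFin_mul_laplace// E /laplace /Rintegral fineK//.
by rewrite -E -EFin_mul_laplace.
Qed.

(** Multiplying the transform of the primitive by [x] gives the transform of
    [distr tau + c * distr sigma], and the term in [c] cancels. *)
Lemma laplace_mul_distr_regular sigma tau (c x : R) : 0 <= c ->
  in_A0 sigma -> in_A0 tau ->
  (forall t, 0 <= t -> (t * distr sigma t)%:E =
    (\int[leb]_(s in `[0%R, t]) (distr tau s + c * distr sigma s)%:E)%E) ->
  0 < x -> x * laplace leb (fun t => t * distr sigma t) x -
    c * laplace leb (distr sigma) x = laplace leb (distr tau) x.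
Proof.
move=> c0 As At E x0.
have sf := in_A0_bounded_finite As; have tf := in_A0_bounded_finite At.
have hs := has_laplace_distr As; have [_ _ it] := has_laplace_distr At.
have [_ _ is_] := hs.
rewrite (laplace_primitive (has_laplace_mul_id hs) _ _ E)//; last 2 first.
- apply: measurable_funD; first exact: measurable_distr.
  by apply: measurable_funM => //; exact: measurable_distr.
- by move=> t; rewrite addr_ge0 ?mulr_ge0 ?distr_ge0.
rewrite /laplace -[X in _ - X]RintegralZl//; last exact: is_.
apply/eqP; rewrite subr_eq -RintegralD//; last 2 first.
- exact: it.
- have : leb.-integrable Rge0
      (fun t => c%:E * (expR (- (x * t)) * distr sigma t)%:E)%E.
    by apply: integrableZl => //; exact: is_.
  by apply: eq_integrable => // t _; rewrite -EFinM.
apply/eqP; apply: eq_Rintegral => t _; ring.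
Qed.

(** Splits [t * distr sigma t] into [distr nu t] and a primitive [P] of [(c + 1) * distr sigma].
    Multiplication of their transforms by [x] gives the transform of the measure [nu] and the
    subtracted term. *)
Lemma laplace_mul_distr_singular sigma nu (c x : R) : 0 <= c ->
  in_A0 sigma -> is_weighted_difference c sigma nu -> 0 < x ->
  (x * laplace leb (fun t => t * distr sigma t) x -
    (c + 1) * laplace leb (distr sigma) x)%:E =
  (\int[nu]_(t in Rge0) (expR (- (x * t)))%:E)%E.
Proof.
move=> c0 As Hd x0; have [n0 _] := Hd; have [s0 _] := As.
have sf := in_A0_bounded_finite As.
have hs := has_laplace_distr As; have hts := has_laplace_mul_id hs.
have c1 : 0 <= c + 1 by rewrite addr_ge0.
have E t : 0 <= t -> (t * distr sigma t)%:E = (nu `[0%R, t]%classic +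
    (c + 1)%:E * \int[leb]_(s in `[0%R, t]) (distr sigma s)%:E)%E.
  exact: weighted_difference_primitive.
have int0 t : (0 <= \int[leb]_(s in `[0%R, t]) (distr sigma s)%:E)%E.
  by apply: integral_ge0 => s _; rewrite lee_fin distr_ge0.
(* By [E], the mass [nu([0, t])] is at most the real number [t * distr sigma t]. *)
have nf : bounded_finite nu.
  move=> t; have [t0|t0] := leP 0 t; last first.
    by rewrite set_itv_ge ?measure0 ?ltry// bnd_simp -ltNge.
  apply: le_lt_trans (ltry (t * distr sigma t)); rewrite E// leeDl//.
  by rewrite mule_ge0 ?lee_fin.
pose P t := t * distr sigma t - distr nu t.
have PE t : 0 <= t ->
    (P t)%:E = (\int[leb]_(s in `[0%R, t]) ((c + 1) * distr sigma s)%:E)%E.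
  move=> t0; under eq_integral do rewrite EFinM.
  rewrite ge0_integralZl_EFin//; last 2 first.
  - by move=> s _; rewrite lee_fin distr_ge0.
  - by apply/measurable_EFinP; exact: measurable_distr.
  rewrite /P EFinB E// -EFin_distr//.
  by rewrite addeAC subee ?add0e.
have P0 t : 0 <= t -> 0 <= P t.
  move=> t0; rewrite -lee_fin PE//; apply: integral_ge0 => s _.
  by rewrite lee_fin mulr_ge0 ?distr_ge0.
have mP (D : set R) : measurable D -> measurable_fun D P.
  move=> mD; apply: measurable_funB; last exact: measurable_distr.
  by apply: measurable_funM => //; exact: measurable_distr.
have mn : measurable_fun (Rge0 : set R) (distr nu) by exact: measurable_distr.
have mx (D : set R) : measurable_fun D (fun t : R => x * expR (- (x * t))).
  by apply: measurable_funM => //; exact: measurable_expRN.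
have me (t : R) : 0 <= x * expR (- (x * t)) by rewrite mulr_ge0 ?expR_ge0 ?(ltW x0).
have HP : (\int[leb]_(t in Rge0) (x * expR (- (x * t)) * P t)%:E =
    ((c + 1) * laplace leb (distr sigma) x)%:E)%E.
  have H := laplace_of_primitive (sigma_finiteT leb)
    (w := fun s => (c + 1) * distr sigma s) _ _ x0.
  transitivity (\int[leb]_(t in Rge0) ((x * expR (- (x * t)))%:E *
      \int[leb]_(s in `[0%R, t]) ((c + 1) * distr sigma s)%:E))%E.
    apply: eq_integral => t; rewrite mem_setE in_itv /= andbT => t0.
    by rewrite EFinM PE.
  rewrite H; last 2 first.
  - by apply: measurable_funM => //; exact: measurable_distr.
  - by move=> t; rewrite mulr_ge0 ?distr_ge0.
  rewrite EFinM EFin_laplace//.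
  under eq_integral do rewrite mulrCA EFinM.
  rewrite ge0_integralZl_EFin//.
  - by move=> t _; rewrite lee_fin mulr_ge0 ?expR_ge0 ?distr_ge0.
  - apply/measurable_EFinP; apply: measurable_funM; first exact: measurable_expRN.
    exact: measurable_distr.
have := EFin_mul_laplace hts x0.
have -> : (\int[leb]_(t in Rge0) (x * expR (- (x * t)) * (t * distr sigma t))%:E =
  \int[leb]_(t in Rge0) (x * expR (- (x * t)) * distr nu t)%:E +
  \int[leb]_(t in Rge0) (x * expR (- (x * t)) * P t)%:E)%E.
  rewrite -ge0_integralD//.
  - by apply: eq_integral => t _; rewrite -EFinD /P; congr (_%:E); ring.
  - by move=> t _; rewrite lee_fin mulr_ge0 ?distr_ge0.
  - by apply/measurable_EFinP; apply: measurable_funM; [exact: mx|exact: mn].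
  - move=> t /=; rewrite in_itv /= andbT => t0.
    by rewrite lee_fin mulr_ge0 ?P0.
  - by apply/measurable_EFinP; apply: measurable_funM; [exact: mx|exact: mP].
(* The transform of [nu] is still an extended real here; the cancellation is legitimate because the
   other summand is a real number. *)
rewrite laplace_of_distr// HP EFinB => ->.
by rewrite addeK.
Qed.

End laplace_recursion.

(** * Consequences of the hypotheses on the derivatives of [p] *)

Section derivative_relations.
Context {R : realType}.
Local Notation leb := (@lebesgue_measure R).
Variables (k : nat) (p : R -> R).
Variable mu : nat -> {measure set (measurableTypeR R) -> \bar R}.
Hypothesis hA0 : forall j : nat, (j < k)%N -> in_A0 (mu j).
Hypothesis hA1 : derivatives_in_A1 k p mu.

Lemma mul_derive1n_distr (j : nat) : (j.+1 < k)%N ->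
  forall t : R, 0 < t -> t ^+ j * derive1n j p t = distr (mu j) t.
Proof.
move=> jk t t0; have [H0 H2] := hA1.
have fj : bounded_finite (mu j) by apply/in_A0_bounded_finite/hA0; lia.
apply: EFin_inj; rewrite EFin_distr//.
case: j jk fj => [|j] jk fj; first by rewrite mul1r H0// ltW.
by have [|_ _ -> //] := H2; lia.
Qed.

(** Merges the cases [j = 0], [0 < j < k - 1] and [j = k - 1]; only the last, for [k >= 2], allows
    an exceptional set. The guard [0 < j] avoids claiming at [j = 0] that [p] itself is
    differentiable. *)
Lemma ae_mul_derive1n_distr (j : nat) : (j < k)%N ->
  {ae leb, forall t : R, 0 < t ->
     ((0 < j)%N -> derivable (derive1n j.-1 p) t 1) /\
     t ^+ j * derive1n j p t = distr (mu j) t}.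
Proof.
move=> jk; have [H0 H2] := hA1.
have fj : bounded_finite (mu j) by apply/in_A0_bounded_finite/hA0.
have [j0|j0] := posnP j.
  apply: aeW => t t0; split; first by rewrite j0.
  by apply: EFin_inj; rewrite EFin_distr// j0 mul1r H0// ltW.
have [|[Cd _] _ Hj Hae] := H2; first by lia.
have [jk1|jk1] := ltnP j.+1 k.
  apply: aeW => t t0; split; last exact: mul_derive1n_distr.
  by move=> _; apply: Cd => //; lia.
have jE : j = (k - 1)%N by lia.
apply: (@filterS _ _ (ae_filter_ringOfSetsType leb) _ _ _ Hae) => t Ht t0.
have [d E] := Ht t0; split.
  by move=> _; rewrite (_ : j.-1 = (k - 2)%N)//; lia.
by apply: EFin_inj; rewrite EFin_distr// {1 2 3}jE.
Qed.

(** For [j = k - 2] this is a hypothesis; for smaller [j] the next derivative exists everywhere and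
    is locally bounded, so the mean value theorem applies. *)
Lemma locally_abs_continuous_derive1n (j : nat) : (j.+1 < k)%N ->
  locally_abs_continuous (derive1n j p).
Proof.
move=> jk; have [H0 H2] := hA1.
have [|[Cd _] Hac Hj _] := H2; first by lia.
have [->//|jk2] := eqVneq j (k - 2)%N.
apply: (@derivable_locally_abs_continuous _ _ j (mu j.+1)).
- by apply/in_A0_bounded_finite/hA0.
- by move=> t t0; apply: Cd => //; lia.
- by move=> t t0; rewrite -derive1nS mul_derive1n_distr//; lia.
Qed.

Lemma mul_distr_succ (j : nat) : (j.+1 < k)%N ->
  forall t : R, 0 <= t -> (t * distr (mu j) t)%:E =
    (\int[leb]_(s in `[0%R, t])
       (distr (mu j.+1) s + j.+1%:R * distr (mu j) s)%:E)%E.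
Proof.
move=> jk; apply: (@mul_distr_primitive _ (derive1n j p)).
- by apply/in_A0_bounded_finite/hA0; lia.
- by apply/in_A0_bounded_finite/hA0.
- exact: locally_abs_continuous_derive1n.
- exact: mul_derive1n_distr.
apply: (@filterS _ _ (ae_filter_ringOfSetsType leb) _ _ _
  (ae_mul_derive1n_distr jk)) => t Ht t0.
by have [d E] := Ht t0; split; [exact: d|rewrite -derive1nS].
Qed.

End derivative_relations.

(** * Induction on the order of the derivative and the three conclusions *)

Unset Implicit Arguments.
Set Strict Implicit.

Theorem theorem1p4 (R : realType) (k : nat) (hk : (1 <= k)%N)
    (f p : R -> R)
    (mu : nat -> {measure set (measurableTypeR R) -> \bar R})
    (hf : forall x : R, 0 < x ->
       (f x)%:E = (\int[@lebesgue_measure R]_(t in `[0%R, +oo[)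
                     (expR (- (x * t)) * p t)%:E)%E)
    (hA0 : forall j : nat, (j < k)%N -> in_A0 (mu j))
    (hA1 : derivatives_in_A1 k p mu)
    (hmuk : is_weighted_difference (k - 1)%:R (mu (k - 1)%N) (mu k)) :
  [/\ (forall j : nat, (j <= k)%N ->
         completely_monotonic
           (fun x : R => (-1) ^+ j * derive1n j (fun y : R => y ^+ j * f y) x)),
      (forall (j : nat) (x : R), (j < k)%N -> 0 < x ->
         ((-1) ^+ j * derive1n j (fun y : R => y ^+ j * f y) x)%:E =
         (\int[@lebesgue_measure R]_(t in `]0%R, +oo[)
            (expR (- (x * t)) * (t ^+ j * derive1n j p t))%:E)%E) &
      (forall x : R, 0 < x ->
         ((-1) ^+ k * derive1n k (fun y : R => y ^+ k * f y) x)%:E =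
         (\int[mu k]_(t in `[0%R, +oo[) (expR (- (x * t)))%:E)%E)].
Proof.
pose u j := fun y : R => y ^+ j * f y.
have uS j : u j.+1 = (fun y => y * u j y).
  by apply/funext => y; rewrite /u exprS mulrA.
have hG j : (j < k)%N -> has_laplace (@lebesgue_measure R) (distr (mu j)).
  by move=> jk; exact/has_laplace_distr/hA0.
(* Smoothness is carried along with the formula, because the Leibniz rule for [u j.+1] needs all
   derivatives of [u j]. *)
have main j : (j < k)%N -> smooth_pos (u j) /\ forall x, 0 < x ->
    (-1) ^+ j * derive1n j (u j) x = laplace (@lebesgue_measure R) (distr (mu j)) x.
  elim: j => [|j IH] jk.
    (* On [[0, +oo[] the function [p] is [distr (mu 0)], so [f] is a Laplace transform and therefore
       smooth. *)
    have E x : 0 < x -> laplace (@lebesgue_measure R) (distr (mu 0%N)) x = u 0%N x.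
      move=> x0; apply: EFin_inj; rewrite EFin_laplace//; last exact: hG.
      rewrite /u mul1r hf//; apply: eq_integral => t.
      rewrite mem_setE in_itv /= andbT => t0; congr (_ * _)%:E.
      apply: EFin_inj; rewrite EFin_distr; last exact/in_A0_bounded_finite/hA0.
      by have [H0 _] := hA1; rewrite H0.
    have [sm _] := derive1n_laplace (hG _ jk).
    split; first exact: eq_smooth_pos E sm.
    by move=> x x0; rewrite mul1r E.
  have jk' : (j < k)%N by lia.
  have [sm E] := IH jk'; rewrite uS; split; first by have [] := leibniz_id_mul sm.
  move=> x x0; rewrite (derive1n_id_mul_laplace sm (hG _ jk'))//.
    apply: laplace_mul_distr_regular => //; [exact: hA0|exact: hA0|].
    exact: (mul_distr_succ hA0 hA1).
  by move=> y y0; rewrite -E// signrMK.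
have k1 : (k - 1 < k)%N by lia.
have last_eq x : 0 < x -> ((-1) ^+ k * derive1n k (u k) x)%:E =
    (\int[mu k]_(t in `[0%R, +oo[) (expR (- (x * t)))%:E)%E.
  move=> x0; have [sm E] := main _ k1.
  rewrite -(laplace_mul_distr_singular _ (hA0 _ k1) hmuk)//.
  (* The step from [k - 1] to [k]: the Leibniz factor [k] is the coefficient [c + 1] for
     [c = k - 1]. *)
  have kE : k = (k - 1).+1 by lia.
  rewrite {1 2 3}kE uS (derive1n_id_mul_laplace sm (hG _ k1))//.
    by rewrite -natr1.
  by move=> y y0; rewrite -E// signrMK.
(* The transform of [mu k] is finite because [last_eq] equates it with a real number. *)
have hk1 : has_laplace (mu k) (cst 1).
  apply: has_laplaceP => //.
  move=> x x0; under eq_integral do rewrite mulr1.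
  by rewrite -last_eq// ltry.
split => //.
- move=> j; rewrite leq_eqVlt => /predU1P[->|jk].
    apply: (laplace_completely_monotonic hk1) => x x0.
    apply: EFin_inj; rewrite EFin_laplace// last_eq//.
    by under [RHS]eq_integral do rewrite mulr1.
  have [_ E] := main _ jk.
  exact: (laplace_completely_monotonic (hG _ jk)).
- move=> j x jk x0; have [_ ->//] := main _ jk.
  have sf : bounded_finite (mu j) by exact/in_A0_bounded_finite/hA0.
  have mG (D : set R) : measurable D -> measurable_fun D
      (fun t => (expR (- (x * t)) * distr (mu j) t)%:E).
    move=> mD; apply/measurable_EFinP; apply: measurable_funM.
      exact: measurable_expRN.
    exact: measurable_distr.
  rewrite EFin_laplace//; last exact: hG.
  (* The origin is Lebesgue-null, which reconciles the closed and the open half-line. *)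
  rewrite -integral_itv_obnd_cbnd; last exact: mG.
  (* For [j = k - 1] the pointwise derivative is tied to [distr (mu j)] only almost everywhere, and
     its measurability is not established, so the comparison relies on the measurability of the
     other integrand. *)
  symmetry; apply: ae_eq_integral_measurabler => //; first exact: mG.
  apply: (@filterS _ _ (ae_filter_ringOfSetsType _) _ _ _
    (ae_mul_derive1n_distr hA0 hA1 jk)) => t Ht.
  by rewrite /= in_itv /= andbT => t0; have [_ ->] := Ht t0.
Qed.
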